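(* Suppose the matrices $P_i$ $(i=1,2,\dots,N)$ in Proximal Jacobian ADMM are adaptively adjusted using the adaptive scheme described in the context. Then the algorithm converges to a solution to the problem $$\min_{\mathbf{x}_1,\ldots,\mathbf{x}_N}\ \sum_{i=1}^N f_i(\mathbf{x}_i)\quad\text{s.t.}\quad \sum_{i=1}^N A_i\mathbf{x}_i=c .$$
   Context: Setting: $N\ge 2$, $\mathbf{x}_i\in\mathbb{R}^{n_i}$, $A_i\in\mathbb{R}^{m\times n_i}$, $c\in\mathbb{R}^m$, and $f_i:\mathbb{R}^{n_i}\to(-\infty,+\infty]$ are closed proper convex functions. It is assumed that a saddle point (KKT point) exists, i.e. some $\mathbf{u}^*=(\mathbf{x}_1^*,\dots,\mathbf{x}_N^*,\lambda^* )$ with $\lambda^*\in\mathbb{R}^m$, $A_i^\top\lambda^*\in\partial f_i(\mathbf{x}_i^* )$ for all $i$, and $\sum_{i=1}^N A_i\mathbf{x}_i^*=c$. Convergence to a solution means that the sequence $\{\mathbf{u}^k\}$ of iterates converges to such a point $\mathbf{u}^*$. Notation: $\mathbf{x}=(\mathbf{x}_1,\dots,\mathbf{x}_N)$, $A=(A_1,\dots,A_N)$, $\mathbf{u}=(\mathbf{x},\lambda)$; $\|\cdot\|$ is the Euclidean norm, $\|\mathbf{z}\|_M^2:=\mathbf{z}^\top M\mathbf{z}$ for symmetric positive semi-definite $M$; $\succ 0$ and $\succeq 0$ mean positive definite and positive semi-definite. Proximal Jacobian ADMM has a penalty parameter $\rho>0$, a damping parameter $\gamma>0$ and symmetric matrices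 $P_i\succeq0$. Starting from $\mathbf{u}^0=(\mathbf{x}^0,\lambda^0)$, one step maps $\mathbf{u}^k$ to $\mathbf{u}^{k+1}$ by, for all $i=1,\dots,N$ in parallel, $$\mathbf{x}_i^{k+1}=\operatorname*{arg\,min}_{\mathbf{x}_i}\ f_i(\mathbf{x}_i)+\frac{\rho}{2}\Big\|A_i\mathbf{x}_i+\sum_{j\ne i}A_j\mathbf{x}_j^k-c-\frac{\lambda^k}{\rho}\Big\|^2+\frac12\|\mathbf{x}_i-\mathbf{x}_i^k\|_{P_i}^2,$$ followed by $\lambda^{k+1}=\lambda^k-\gamma\rho\big(\sum_{i=1}^N A_i\mathbf{x}_i^{k+1}-c\big)$. For given matrices $P_i$ let $G_x:=\operatorname{blockdiag}(P_1+\rho A_1^\top A_1,\dots,P_N+\rho A_N^\top A_N)$, $G:=\operatorname{blockdiag}\big(G_x,\frac{1}{\gamma\rho}\mathbf{I}\big)$ with $\mathbf{I}$ the $m\times m$ identity, and $$h(\mathbf{u}^k,\mathbf{u}^{k+1}):=\|\mathbf{x}^k-\mathbf{x}^{k+1}\|_{G_x}^2+\frac{2-\gamma}{\rho\gamma^2}\|\lambda^k-\lambda^{k+1}\|^2+\frac{2}{\gamma}(\lambda^k-\lambda^{k+1})^\top A(\mathbf{x}^k-\mathbf{x}^{k+1}).$$ Adaptive scheme: initialize with small $P_i^0\succeq0$ $(i=1,\dots,N)$ and a (sufficiently) small $\eta>0$. For $k=1,2,\dots$, after $\mathbf{u}^k$ has been computed from $\mathbf{u}^{k-1}$ with the current matrices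 $P_i$: if $h(\mathbf{u}^{k-1},\mathbf{u}^k)>\eta\cdot\|\mathbf{u}^{k-1}-\mathbf{u}^k\|_G^2$ ($h$ and $G$ formed with the current $P_i$), keep $P_i$ unchanged for all $i$; otherwise increase $P_i$, replacing it by $\alpha_iP_i+\beta_iQ_i$ for all $i$, where $\alpha_i>1$, $\beta_i\ge0$, $Q_i\succ0$, and restart, i.e. set $\mathbf{u}^k\leftarrow\mathbf{u}^{k-1}$.
   Formalization: Assumes η<min(1,2/γ−1), so γ<2; each increase of P_i is strict (new minus old positive definite, barring β_i=0 with singular P_i); and subproblems with the initial P_i have unique minimizers. Otherwise the scheme may restart forever at a non-solution or be ill-defined. *)

(* Defs.v *)
From HB Require Import structures.
From mathcomp Require Import all_boot all_order all_algebra.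
From mathcomp Require Import all_classical all_reals all_analysis.

Set Implicit Arguments.
Unset Strict Implicit.
Unset Printing Implicit Defensive.

Import Order.TTheory GRing.Theory Num.Theory.
Import numFieldNormedType.Exports.

Local Open Scope classical_set_scope.
Local Open Scope ring_scope.

Section QuadraticForms.
Context {R : realType} {n : nat}.
Implicit Types (M : 'M[R]_n) (z : 'cV[R]_n).

(* ||z||_M ^ 2 = z^T M z *)
Definition sqnorm M z : R := (z^T *m M *m z) 0 0.

Definition psdmx M : Prop := M^T = M /\ forall z, 0 <= sqnorm M z.

Definition posdefmx M : Prop := M^T = M /\ forall z, z != 0 -> 0 < sqnorm M z.

End QuadraticForms.

Section ConvexAnalysis.
Context {R : realType} {n : nat}.
Implicit Types (f : 'cV[R]_n -> \bar R) (x y z g : 'cV[R]_n).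

(* The right-hand side is never of the form +oo - oo when f is proper, and
   0 * +oo = 0, so the endpoints t = 0, 1 carry no information. *)
Definition convex_efun f : Prop := forall x y (t : R), 0 <= t <= 1 ->
  (f (t *: x + (1 - t) *: y)%R <= t%:E * f x + (1 - t)%R%:E * f y)%E.

Definition proper_efun f : Prop :=
  (forall x, f x != -oo%E) /\ (exists x, (f x < +oo)%E).

(* For a proper convex function, closedness is lower semicontinuity. *)
Definition closed_proper_convex f : Prop :=
  [/\ lower_semicontinuous f, proper_efun f & convex_efun f].

Definition subdifferential f x : set 'cV[R]_n :=
  [set g | forall y, (f x + ((g^T *m (y - x)) 0 0)%R%:E <= f y)%E].

Definition argmin f : set 'cV[R]_n := [set z | forall y, (f z <= f y)%E].

End ConvexAnalysis.

Section ProximalJacobianADMM.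
Context {R : realType} {N m : nat} {n : 'I_N -> nat}.

(* u = (x_1, ..., x_N, lambda) *)
Definition iterate : Type := ((forall i, 'cV[R]_(n i)) * 'cV[R]_m)%type.

Variables (A : forall i, 'M[R]_(m, n i)) (c : 'cV[R]_m).
Variable f : forall i, 'cV[R]_(n i) -> \bar R.
Arguments f : clear implicits.

Definition kkt_point (u : iterate) : Prop :=
  (forall i, subdifferential (f i) (u.1 i) ((A i)^T *m u.2)) /\
  \sum_i A i *m u.1 i = c.

Variables rho gamma : R.

Implicit Types (P Q : forall i, 'M[R]_(n i)) (u v w : iterate).

Definition subproblem P u (i : 'I_N) (z : 'cV[R]_(n i)) : \bar R :=
  let r := A i *m z + \sum_(j | j != i) A j *m u.1 j - c - rho^-1 *: u.2 in
  let q := rho / 2 * sqnorm 1%:M r + 1 / 2 * sqnorm (P i) (z - u.1 i) in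
  (f i z + q%:E)%E.

(* The defining equation x_i^(k+1) = argmin (...) has a meaning, i.e. a step is
   a map u |-> v. This is automatic for closed proper convex f_i as soon as
   every P_i + rho A_i^T A_i is positive definite. *)
Definition well_posed P : Prop :=
  forall u (i : 'I_N), exists z, argmin (@subproblem P u i) = [set z].

Definition admm_step P u v : Prop :=
  (forall i, argmin (@subproblem P u i) = [set v.1 i]) /\
  v.2 = u.2 - (gamma * rho) *: (\sum_i A i *m v.1 i - c).

Definition stackx (x : forall i, 'cV[R]_(n i)) : 'cV[R]_(\sum_i n i) :=
  \mxcol_i x i.

Definition stack u : 'cV[R]_(\sum_i n i + m) := col_mx (stackx u.1) u.2.

Definition rowA : 'M[R]_(m, \sum_i n i) := \mxrow_i A i.

Definition Gx P : 'M[R]_(\sum_i n i) :=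
  \mxdiag_i (P i + rho *: ((A i)^T *m A i)).

Definition G P : 'M[R]_(\sum_i n i + m) :=
  block_mx (Gx P) 0 0 (gamma * rho)^-1%:M.

Definition h P u v : R :=
  let dx := stackx u.1 - stackx v.1 in
  let dl := u.2 - v.2 in
  sqnorm (Gx P) dx + (2 - gamma) / (rho * gamma ^+ 2) * sqnorm 1%:M dl
  + 2 / gamma * (dl^T *m rowA *m dx) 0 0.

Definition accept (eta : R) P u v : Prop :=
  eta * sqnorm (G P) (stack u - stack v) < h P u v.

Variables (eta : R) (alpha beta : 'I_N -> R) (Q : forall i, 'M[R]_(n i)).

(* "Increase P_i" is strict in the Loewner order. This is automatic when
   0 < beta i or P i is positive definite; it rules out the replacement of a
   singular P i by alpha i *: P i, which leaves P i unchanged on its kernel. *)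
Definition increased P P' : Prop := forall i,
  P' i = alpha i *: P i + beta i *: Q i /\ posdefmx (P' i - P i).

(* On a rejection the tentative point v is discarded, and the iterate u k is
   repeated (the restart u^k <- u^(k-1)). *)
Definition adaptive_run (u : nat -> iterate)
    (P : nat -> forall i, 'M[R]_(n i)) : Prop :=
  forall k, exists v, admm_step (P k) (u k) v /\
    ((accept eta (P k) (u k) v /\ u k.+1 = v /\ P k.+1 = P k) \/
     (~ accept eta (P k) (u k) v /\ u k.+1 = u k /\ increased (P k) (P k.+1))).

End ProximalJacobianADMM.

Arguments iterate : clear implicits.

(* Componentwise; equivalent to convergence of stack (u k) in Euclidean space. *)
Definition converges_to {R : realType} {N m : nat} {n : 'I_N -> nat}
    (u : nat -> iterate R N m n) (w : iterate R N m n) : Prop :=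
  (forall i, ((fun k => (u k).1 i) @ \oo --> w.1 i)) /\
  ((fun k => (u k).2) @ \oo --> w.2).

(* Main.v *)
Require Import Defs.
From HB Require Import structures.
From mathcomp Require Import all_boot all_order all_algebra.
From mathcomp Require Import all_classical all_reals all_analysis.
From mathcomp Require Import ring lra.

Set Implicit Arguments.
Unset Strict Implicit.
Unset Printing Implicit Defensive.

Import Order.TTheory GRing.Theory Num.Theory.
Import numFieldNormedType.Exports.

Local Open Scope classical_set_scope.
Local Open Scope ring_scope.

(* Write D_i for the Bregman distance of f_i at a KKT point u*.  The optimality
   conditions of the subproblems give, for every step u -> v,
     2 sum_i D_i(v_i) + h(u, v) <= ||u - u*||_G^2 - ||v - u*||_G^2.
   If steps are rejected infinitely often, the P_i grow without bound in the
   Loewner order, and then h > eta ||u - v||_G^2 for every nontrivial step; so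
   some rejected step is trivial, the iterate is a KKT point, and it is never
   left again.  Otherwise P is eventually constant, and ||u^k - u*||_G decreases
   while ||u^k - u^(k+1)||_G tends to 0.

   G may be singular, so this alone does not bound the iterates.  But
   well-posedness says that D_i + 1/2 ||. - x_i*||^2, in the seminorm of
   P_i + rho A_i^T A_i, vanishes only at x_i*; by convexity it then grows at
   least linearly away from x_i*, and the descent inequality bounds it along the
   iterates.  Hence they are bounded, any cluster point is a KKT point, and using
   it as u* makes the right-hand side tend to 0. *)

(** * Quadratic forms on column vectors *)

Section InnerProduct.
Context {R : realType}.

Definition dot {n} (a b : 'cV[R]_n) : R := (a^T *m b) 0 0.

Lemma dotE n (a b : 'cV[R]_n) : dot a b = \sum_i a i 0 * b i 0.
Proof. by rewrite /dot mxE; apply: eq_bigr => i _; rewrite mxE. Qed.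

Lemma dotC n (a b : 'cV[R]_n) : dot a b = dot b a.
Proof. by rewrite !dotE; apply: eq_bigr => i _; rewrite mulrC. Qed.

Lemma dotDl n (a b d : 'cV[R]_n) : dot (a + b) d = dot a d + dot b d.
Proof. by rewrite /dot linearD mulmxDl mxE. Qed.

Lemma dotDr n (a b d : 'cV[R]_n) : dot d (a + b) = dot d a + dot d b.
Proof. by rewrite dotC dotDl ![dot _ d]dotC. Qed.

Lemma dotZl n k (a b : 'cV[R]_n) : dot (k *: a) b = k * dot a b.
Proof. by rewrite /dot linearZ -scalemxAl mxE. Qed.

Lemma dotZr n k (a b : 'cV[R]_n) : dot a (k *: b) = k * dot a b.
Proof. by rewrite dotC dotZl dotC. Qed.

Lemma dotNl n (a b : 'cV[R]_n) : dot (- a) b = - dot a b.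
Proof. by rewrite -scaleN1r dotZl mulN1r. Qed.

Lemma dotNr n (a b : 'cV[R]_n) : dot a (- b) = - dot a b.
Proof. by rewrite dotC dotNl dotC. Qed.

Lemma dotBl n (a b d : 'cV[R]_n) : dot (a - b) d = dot a d - dot b d.
Proof. by rewrite dotDl dotNl. Qed.

Lemma dotBr n (a b d : 'cV[R]_n) : dot d (a - b) = dot d a - dot d b.
Proof. by rewrite dotDr dotNr. Qed.

Definition dot_lin :=
  (@dotBl, @dotBr, @dotDl, @dotDr, @dotZl, @dotZr, @dotNl, @dotNr).

Lemma dot0l n (a : 'cV[R]_n) : dot 0 a = 0.
Proof. by rewrite -(scale0r a) dotZl mul0r. Qed.

Lemma dot0r n (a : 'cV[R]_n) : dot a 0 = 0.
Proof. by rewrite dotC dot0l. Qed.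

Lemma dot_suml n (I : finType) (a : I -> 'cV[R]_n) b :
  dot (\sum_i a i) b = \sum_i dot (a i) b.
Proof.
apply: (big_ind2 (fun x y => dot x b = y)) => //; first exact: dot0l.
by move=> x y x' y' <- <-; rewrite dotDl.
Qed.

Lemma dot_sumr n (I : finType) (a : I -> 'cV[R]_n) b :
  dot b (\sum_i a i) = \sum_i dot b (a i).
Proof. by rewrite dotC dot_suml; apply: eq_bigr => i _; rewrite dotC. Qed.

Lemma dot_mulmxl m n (A : 'M[R]_(m, n)) a b : dot (A *m a) b = dot a (A^T *m b).
Proof. by rewrite /dot trmx_mul mulmxA. Qed.

Lemma dot_mulmxr m n (A : 'M[R]_(m, n)) a b : dot a (A *m b) = dot (A^T *m a) b.
Proof. by rewrite dot_mulmxl trmxK. Qed.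

Lemma dotvv_ge0 n (a : 'cV[R]_n) : 0 <= dot a a.
Proof. by rewrite dotE sumr_ge0// => i _; rewrite -expr2 sqr_ge0. Qed.

Lemma sqr_entry_le_dot n (a : 'cV[R]_n) i j : (a i j) ^+ 2 <= dot a a.
Proof.
rewrite ord1 dotE (bigD1 i)//= -expr2 lerDl sumr_ge0// => k _.
by rewrite -expr2 sqr_ge0.
Qed.

Lemma dotvv_eq0 n (a : 'cV[R]_n) : dot a a = 0 -> a = 0.
Proof.
move=> a0; apply/matrixP => i j; rewrite mxE; apply/eqP.
by rewrite -sqrf_eq0 eq_le sqr_ge0 andbT -a0 sqr_entry_le_dot.
Qed.

Lemma dotvv_gt0 n (a : 'cV[R]_n) : a != 0 -> 0 < dot a a.
Proof.
move=> a0; rewrite lt_neqAle dotvv_ge0 andbT.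
by apply: contraNneq a0 => /esym/dotvv_eq0 ->.
Qed.

Lemma dot_sqrDZ n (k : R) (a b : 'cV[R]_n) :
  dot (a + k *: b) (a + k *: b) = dot a a + 2 * k * dot a b + k ^+ 2 * dot b b.
Proof. by rewrite !dot_lin (dotC b a); ring. Qed.

Lemma sqnormE n (M : 'M[R]_n) z : sqnorm M z = dot z (M *m z).
Proof. by rewrite /sqnorm /dot mulmxA. Qed.

Lemma sqnorm1 n (z : 'cV[R]_n) : sqnorm 1%:M z = dot z z.
Proof. by rewrite sqnormE mul1mx. Qed.

Lemma sqnorm0 n (M : 'M[R]_n) : sqnorm M 0 = 0.
Proof. by rewrite sqnormE dot0l. Qed.

Lemma sqnormZ n (M : 'M[R]_n) k z : sqnorm M (k *: z) = k ^+ 2 * sqnorm M z.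
Proof. by rewrite !sqnormE -scalemxAr !dot_lin expr2 mulrA. Qed.

Lemma sqnormN n (M : 'M[R]_n) z : sqnorm M (- z) = sqnorm M z.
Proof. by rewrite !sqnormE mulmxN !dot_lin opprK. Qed.

Lemma sqnorm_addl n (M M' : 'M[R]_n) z :
  sqnorm (M + M') z = sqnorm M z + sqnorm M' z.
Proof. by rewrite !sqnormE mulmxDl dotDr. Qed.

Lemma sqnorm_scalel n k (M : 'M[R]_n) z : sqnorm (k *: M) z = k * sqnorm M z.
Proof. by rewrite !sqnormE -scalemxAl dotZr. Qed.

Lemma sqnorm_subl n (M M' : 'M[R]_n) z :
  sqnorm (M - M') z = sqnorm M z - sqnorm M' z.
Proof. by rewrite -scaleN1r sqnorm_addl sqnorm_scalel mulN1r. Qed.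

Lemma sqnorm_gram m n (A : 'M[R]_(m, n)) z :
  sqnorm (A^T *m A) z = dot (A *m z) (A *m z).
Proof. by rewrite sqnormE -mulmxA dot_mulmxl. Qed.

Lemma sqnorm_sub n (M : 'M[R]_n) a b : M^T = M ->
  sqnorm M (a - b) = sqnorm M a - 2 * dot a (M *m b) + sqnorm M b.
Proof.
move=> sM; rewrite !sqnormE mulmxBr !dot_lin.
by rewrite (dotC b (M *m a)) dot_mulmxl sM; ring.
Qed.

Lemma sqnorm_add n (M : 'M[R]_n) a b : M^T = M ->
  sqnorm M (a + b) = sqnorm M a + 2 * dot a (M *m b) + sqnorm M b.
Proof.
by move=> sM; rewrite -{1}(opprK b) sqnorm_sub// sqnormN mulmxN dotNr; ring.
Qed.

Lemma posdefmx_psd n (D : 'M[R]_n) : posdefmx D -> psdmx D.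
Proof.
move=> [sD pD]; split=> // z.
have [->|z0] := eqVneq z 0; last exact: ltW (pD z z0).
by rewrite sqnorm0.
Qed.

(* The discriminant of t |-> ||a + t b||_M^2 at a kernel direction a. *)
Lemma psdmx_kernel n (M : 'M[R]_n) z : psdmx M -> sqnorm M z = 0 -> M *m z = 0.
Proof.
move=> [sM pM] z0; apply: dotvv_eq0; set w := M *m z.
have H (t : R) : 0 <= 2 * t * dot w w + t ^+ 2 * sqnorm M w.
  have := pM (z + t *: w).
  rewrite sqnorm_add// sqnormZ z0 -scalemxAr dotZr dot_mulmxr sM -/w.
  by rewrite add0r mulrA.
apply/eqP; rewrite eq_le dotvv_ge0 andbT leNgt; apply/negP => w0.
have := pM w; rewrite le_eqVlt => /predU1P[e|lt0].
  by have := H (-1); rewrite -e; lra.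
(* This [t] minimises the quadratic in [H]; its value there is negative. *)
have := H (- (dot w w / sqnorm M w)).
have -> : 2 * - (dot w w / sqnorm M w) * dot w w
  + (- (dot w w / sqnorm M w)) ^+ 2 * sqnorm M w = - (dot w w ^+ 2 / sqnorm M w).
  by field; rewrite gt_eqF.
by rewrite oppr_ge0 leNgt divr_gt0// exprn_gt0.
Qed.

End InnerProduct.

(** * Limits along filters *)

Section Limits.
Context {R : realType} {T : Type} {F : set_system T} {FF : Filter F}.

Lemma cvg_mxP m n (x : T -> 'M[R]_(m, n)) (l : 'M[R]_(m, n)) :
  x @ F --> l <-> forall i j, (fun t => x t i j) @ F --> l i j.
Proof.
split=> [xl i j|xl].
  exact: (cvg_comp _ _ xl (@coord_continuous R m n i j l)).
apply/cvgrPdist_lt => e e0.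
have : F [set t | forall ij : 'I_m * 'I_n, `|l ij.1 ij.2 - x t ij.1 ij.2| < e].
  by apply: filter_forall => -[i j] /=; move/cvgrPdist_lt: (xl i j); apply.
apply: filterS => t xt; rewrite [ltLHS]mx_normrE; apply/bigmax_ltP.
by split=> // -[i j] _ /=; have := xt (i, j); rewrite !mxE.
Qed.

Lemma cvg_sumr (I : finType) (x : I -> T -> R) (l : I -> R) :
  (forall i, x i @ F --> l i) -> (fun t => \sum_i x i t) @ F --> \sum_i l i.
Proof. by move=> xl; apply: cvg_big => // -[a b]; exact: add_continuous. Qed.

Lemma cvg_mulmx m n p (x : T -> 'M[R]_(m, n)) (y : T -> 'M[R]_(n, p))
    (k : 'M[R]_(m, n)) (l : 'M[R]_(n, p)) :
  x @ F --> k -> y @ F --> l -> (fun t => x t *m y t) @ F --> k *m l.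
Proof.
move=> /cvg_mxP xk /cvg_mxP yl; apply/cvg_mxP => i j; rewrite mxE.
under eq_cvg do rewrite mxE.
by apply: cvg_sumr => h; apply: cvgM.
Qed.

Lemma cvg_trmx m n (x : T -> 'M[R]_(m, n)) (l : 'M[R]_(m, n)) :
  x @ F --> l -> (fun t => (x t)^T) @ F --> l^T.
Proof.
move=> /cvg_mxP xl; apply/cvg_mxP => i j; rewrite mxE.
by under eq_cvg do rewrite mxE; exact: xl.
Qed.

Lemma cvg_dot n (x y : T -> 'cV[R]_n) (k l : 'cV[R]_n) :
  x @ F --> k -> y @ F --> l -> (fun t => dot (x t) (y t)) @ F --> dot k l.
Proof.
by move=> xk yl; have /cvg_mxP := cvg_mulmx (cvg_trmx xk) yl; exact.
Qed.

Lemma cvg_mulmxl m n p (A : 'M[R]_(m, n)) (y : T -> 'M[R]_(n, p))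
    (l : 'M[R]_(n, p)) :
  y @ F --> l -> (fun t => A *m y t) @ F --> A *m l.
Proof. exact: (@cvg_mulmx _ _ _ (fun=> A) _ _ _ (cvg_cst A)). Qed.

Lemma cvg_sqnorm n (M : 'M[R]_n) (x : T -> 'cV[R]_n) (l : 'cV[R]_n) :
  x @ F --> l -> (fun t => sqnorm M (x t)) @ F --> sqnorm M l.
Proof.
move=> xl; rewrite sqnormE; under eq_cvg do rewrite sqnormE.
by apply: cvg_dot => //; exact: cvg_mulmxl.
Qed.

Lemma cvg_summx (I : finType) m n (x : I -> T -> 'M[R]_(m, n))
    (l : I -> 'M[R]_(m, n)) :
  (forall i, x i @ F --> l i) -> (fun t => \sum_i x i t) @ F --> \sum_i l i.
Proof.
move=> xl; apply/cvg_mxP => i j; rewrite summxE.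
under eq_cvg do rewrite summxE.
by apply: cvg_sumr => k; move/cvg_mxP: (xl k); exact.
Qed.

Lemma cvg_dot_sub0 n (x : T -> 'cV[R]_n) (l : 'cV[R]_n) :
  (forall e, 0 < e -> \forall t \near F, dot (x t - l) (x t - l) < e) ->
  x @ F --> l.
Proof.
move=> xl; apply/cvg_mxP => i j; apply/cvgrPdist_lt => e e0.
apply: filterS (xl (e ^+ 2) (exprn_gt0 _ e0)) => t.
rewrite distrC; move/(le_lt_trans (sqr_entry_le_dot (x t - l) i j)).
by rewrite !mxE -[in X in X < _]real_normK ?num_real// ltr_pXn2r ?nnegrE// ltW.
Qed.

(** Near [l] lower semicontinuity keeps [f] above a level strictly between [b] and [f l], while the
    bounds [a t] fall below that level. *)
Lemma lsc_le_cvg {PF : ProperFilter F} (X : topologicalType) (f : X -> \bar R)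
    (x : T -> X) (l : X) (a : T -> R) (b : R) :
  lower_semicontinuous f -> x @ F --> l -> a @ F --> b ->
  (\forall t \near F, (f (x t) <= (a t)%:E)%E) -> (f l <= b%:E)%E.
Proof.
move=> lf xl ab fa; rewrite leNgt; apply/negP => bfl.
have [d bd dfl] : exists2 d, b < d & (d%:E < f l)%E.
  case: (f l) bfl => [r||]//=.
    by rewrite lte_fin => br; exists ((b + r) / 2); rewrite ?lte_fin; lra.
  by move=> _; exists (b + 1); rewrite ?ltry//; lra.
have [V lV Vf] := lf _ _ dfl.
have FV : F [set t | V (x t)] by exact: xl.
have [t [[/Vf dfx fxa] ad]] :=
  filter_ex (filterI (filterI FV fa) (cvgr_lt b ab d bd)).
by have := lt_le_trans dfx fxa; rewrite lte_fin => /(lt_trans ad); rewrite ltxx.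
Qed.

End Limits.

(** * Ultrafilter limits in place of convergent subsequences *)

Section Compactness.
Context {R : realType}.

(** Along an ultrafilter finer than [\oo] all bounded sequences converge simultaneously, which
    replaces successive extractions of subsequences. *)
Lemma ultra_infty : exists U : set_system nat, UltraFilter U /\ \oo `<=` U.
Proof. exact: ultraFilterLemma. Qed.

Lemma ultra_fmap {T S} (U : set_system T) (x : T -> S) :
  UltraFilter U -> UltraFilter (x @ U).
Proof.
move=> UU; split; first exact: fmap_proper_filter.
move=> G PG UG; apply/seteqP; split=> // A GA.
(* Otherwise the complement of [A] lies in the image filter, hence in [G] together with [A]. *)
have [//|UA] := in_ultra_setVsetC (x @^-1` A) UU.
have : G set0 by rewrite -(setICr A); apply: filterI GA _; apply: UG.
by move=> /filter_ex[].
Qed.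

Lemma ultra_cvg_bounded {T} (U : set_system T) n (x : T -> 'cV[R]_n) B :
  UltraFilter U -> (\forall t \near U, dot (x t) (x t) <= B) ->
  exists l : 'cV[R]_n, x @ U --> l.
Proof.
move=> UU xB.
have xl i : exists l : R, (fun t => x t i 0) @ U --> l.
  (* The segment is wide enough because [x ^+ 2 <= B] forces [|x| <= B + 1]. *)
  have := @segment_compact R (- (B + 1)) (B + 1); rewrite compact_ultra.
  move=> /(_ ((fun t => x t i 0) @ U) (ultra_fmap _ UU))[|l [_ xl]]; last first.
    by exists l.
  apply: filterS xB => t /(le_trans (sqr_entry_le_dot (x t) i 0)) xtB /=.
  by rewrite in_itv/=; nra.
have [l xlP] := choice xl.
by exists (\col_i l i); apply/cvg_mxP => i j; rewrite ord1 mxE.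
Qed.

End Compactness.

(** * Bregman distances of closed convex functions *)

Section Convexity.
Context {R : realType} {n : nat}.
Implicit Types (f : 'cV[R]_n -> \bar R) (x y g : 'cV[R]_n) (M : 'M[R]_n).

(* Junk when [f x] or [f y] is infinite. *)
Definition bregman f x g y : R := fine (f y) - fine (f x) - dot g (y - x).

Lemma subdifferential_fin f x g :
  proper_efun f -> subdifferential f x g -> f x \is a fin_num.
Proof.
move=> [fN [y fy]] gx; rewrite fin_numE fN /=.
apply/negP => /eqP fx; have := gx y; rewrite fx addye//.
by rewrite leye_eq => /eqP fy'; rewrite fy' ltxx in fy.
Qed.

Lemma bregman_ge0 f x g y : proper_efun f -> subdifferential f x g ->
  f y \is a fin_num -> 0 <= bregman f x g y.
Proof.
move=> pf gx fy; have fx := subdifferential_fin pf gx.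
have := gx y; rewrite /bregman -(fineK fx) -(fineK fy) -EFinD lee_fin /dot/=.
by rewrite -subr_ge0; lra.
Qed.

Lemma subdifferentialP f x g : f x \is a fin_num ->
  (forall y, f y != -oo%E) ->
  (forall y, f y \is a fin_num -> 0 <= bregman f x g y) ->
  subdifferential f x g.
Proof.
move=> fx fN gx y; case E : (f y) => [r||].
- have := gx y; rewrite /bregman -(fineK fx) E -EFinD lee_fin /dot/=.
  by move=> /(_ isT); lra.
- exact: leey.
- by have := fN y; rewrite E.
Qed.

Lemma convex_fin f x y (t : R) : proper_efun f -> convex_efun f ->
  f x \is a fin_num -> f y \is a fin_num -> 0 <= t <= 1 ->
  f (x + t *: (y - x)) \is a fin_num /\
  fine (f (x + t *: (y - x))) <= t * fine (f y) + (1 - t) * fine (f x).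
Proof.
move=> [fN _] cf fx fy t01.
have -> : x + t *: (y - x) = t *: y + (1 - t) *: x.
  by rewrite scalerBl scale1r scalerBr addrCA.
have := cf y x t t01; rewrite -(fineK fx) -(fineK fy) -!EFinM -EFinD.
move: (fN (t *: y + (1 - t) *: x)).
by case: (f (t *: y + (1 - t) *: x)) => [r||].
Qed.

(** The quadratic term is of second order at [x], so along a segment from [x] convexity leaves only
    the first-order inequality. *)
Lemma minimizer_subdifferential f M x g :
  proper_efun f -> convex_efun f ->
  (forall y, f x <= f y + (1 / 2 * sqnorm M (y - x) - dot g (y - x))%R%:E)%E ->
  subdifferential f x g.
Proof.
move=> pf cf xmin; have fx : f x \is a fin_num.
  have [fN [y fy]] := pf; rewrite fin_numE fN /= -ltey.
  apply: le_lt_trans (xmin y) _.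
  by case: (f y) fy => // r _; rewrite -EFinD ltry.
apply: subdifferentialP => //; first by case: pf.
move=> y fy; rewrite leNgt; apply/negP => d0.
set s := `|sqnorm M (y - x)|; set d := bregman f x g y in d0 *.
have s0 : 0 <= s by exact: normr_ge0.
have sM : sqnorm M (y - x) <= s by exact: ler_norm.
(* Moving to [x + t (y - x)] changes the objective by at most [t * d + t ^+ 2 * s / 2], which is
   negative for this [t] because [t * s <= - d]. *)
pose t := - d / (- d + s).
have t0 : 0 < t by rewrite divr_gt0//; lra.
have t1 : t <= 1 by rewrite ler_pdivrMr; lra.
have ts : t * (- d + s) = - d by rewrite /t divfK// gt_eqF//; lra.
have [fp] := @convex_fin f x y t pf cf fx fy (introT andP (conj (ltW t0) t1)).
have := xmin (x + t *: (y - x));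
rewrite [x + _ - x]addrAC subrr add0r sqnormZ dotZr.
rewrite -(fineK fx) -(fineK fp) -EFinD lee_fin => h1 h2.
have h3 : 0 <= t * d + t * t * s / 2.
  have : t ^+ 2 * sqnorm M (y - x) <= t * t * s.
    by rewrite expr2 ler_wpM2l// mulr_ge0// ltW.
  by rewrite /d /bregman; lra.
have h4 : 0 <= t * (d + t * s / 2) by lra.
by move: h4; rewrite pmulr_rge0//; nra.
Qed.

(** For each [y] the subgradient inequality passes to the limit, by lower semicontinuity in the term
    [f (x t)] and by continuity in the others. *)
Lemma subdifferential_closed f T (U : set_system T) (x g : T -> 'cV[R]_n)
    (xl gl : 'cV[R]_n) :
  ProperFilter U -> lower_semicontinuous f -> proper_efun f ->
  x @ U --> xl -> g @ U --> gl ->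
  (forall t, subdifferential f (x t) (g t)) -> subdifferential f xl gl.
Proof.
move=> PU lf pf xxl ggl gx.
have fle y : f y \is a fin_num -> (f xl <= (fine (f y) - dot gl (y - xl))%:E)%E.
  move=> fy; apply: (@lsc_le_cvg _ _ U _ _ _ f x _
    (fun t => fine (f y) - dot (g t) (y - x t))) => //.
    apply: cvgB; first exact: cvg_cst.
    by apply: cvg_dot => //; apply: cvgB => //; exact: cvg_cst.
  apply: filterE => t; have fx := subdifferential_fin pf (gx t).
  have := bregman_ge0 pf (gx t) fy.
  by rewrite /bregman -{2}(fineK fx) lee_fin; lra.
have [fN [y0 fy0]] := pf.
have fxl : f xl \is a fin_num.
  rewrite fin_numE fN -ltey /=; apply: le_lt_trans (fle y0 _) (ltry _).
  by rewrite fin_numE fN -ltey.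
apply: subdifferentialP => // y fy.
by have := fle y fy; rewrite -(fineK fxl) lee_fin /bregman; lra.
Qed.

End Convexity.

(** * Growth estimates from compactness of spheres *)

Section Growth.
Context {R : realType} {n : nat}.
Implicit Types (f : 'cV[R]_n -> \bar R) (x y g : 'cV[R]_n) (M : 'M[R]_n).

(** Points of the sphere with values below [1 / (k + 1)] for every [k] would accumulate at a point
    of the sphere with value at most 0. *)
Lemma bregman_sphere f M x g (e : R) : closed_proper_convex f ->
  subdifferential f x g ->
  (forall y, f y \is a fin_num -> y != x ->
    0 < bregman f x g y + 1 / 2 * sqnorm M (y - x)) ->
  0 < e ->
  exists d : R, 0 < d /\ forall y, f y \is a fin_num -> dot (y - x) (y - x) = e ->
    d <= bregman f x g y + 1 / 2 * sqnorm M (y - x).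
Proof.
move=> [lf pf cf] gx xuniq e0; apply: contrapT => nd.
have fx := subdifferential_fin pf gx.
have /choice[q qP] : forall k : nat, exists q, [/\ f (x + q) \is a fin_num,
    dot q q = e & bregman f x g (x + q) + 1 / 2 * sqnorm M q < harmonic k].
  move=> k; apply: contrapT => nq; apply: nd; exists (harmonic k).
  split=> [|y fy ye]; first exact: harmonic_gt0.
  rewrite leNgt; apply/negP => yk; apply: nq; exists (y - x).
  by rewrite addrC subrK.
have [U [UU Uoo]] := ultra_infty.
have [l ql] : exists l : 'cV[R]_n, q @ U --> l.
  apply: (@ultra_cvg_bounded _ _ _ _ _ e) => //.
  by apply: filterE => k; have [_ -> _] := qP k.
have dle : dot l l = e.
  have : dot (q k) (q k) @[k --> U] --> dot l l by exact: cvg_dot.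
  have -> : (fun k => dot (q k) (q k)) = fun=> e.
    by apply/funext => k; have [_ ->] := qP k.
  by move/cvg_unique; apply => //; exact: cvg_cst.
(* Lower semicontinuity is available for [f] alone, so the inequality is solved for [f] before
   passing to the limit. *)
have fl : (f (x + l)%R <= (fine (f x) + dot g l - 1 / 2 * sqnorm M l + 0)%R%:E)%E.
  apply: (@lsc_le_cvg _ _ U _ _ _ f (fun k => x + q k) _
    (fun k => fine (f x) + dot g (q k) - 1 / 2 * sqnorm M (q k) + harmonic k)) => //.
  - by apply: cvgD => //; exact: cvg_cst.
  - apply: cvgD; last by move=> A /cvg_harmonic /Uoo.
    apply: cvgB; last by apply: cvgM; [exact: cvg_cst|exact: cvg_sqnorm].
    by apply: cvgD; [exact: cvg_cst|apply: cvg_dot => //; exact: cvg_cst].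
  - apply: filterE => k; have [fq _] := qP k.
    by rewrite /bregman [x + _ - x]addrAC subrr add0r -{2}(fineK fq) lee_fin; lra.
have fxl : f (x + l) \is a fin_num.
  by rewrite fin_numE; case: pf => -> _ /=; rewrite -ltey (le_lt_trans fl)// ltry.
move: fl; rewrite -(fineK fxl) lee_fin addr0.
have : x + l != x.
  rewrite -subr_eq0 [x + _ - x]addrAC subrr add0r.
  by apply: contraTneq e0 => l0; rewrite -dle l0 dot0l ltxx.
by move=> /(xuniq _ fxl); rewrite /bregman [x + _ - x]addrAC subrr add0r; lra.
Qed.

(* Convexity propagates the positive lower bound on a sphere linearly outwards. *)
Lemma bregman_growth f M x g (e : R) : closed_proper_convex f -> psdmx M ->
  subdifferential f x g ->
  (forall y, f y \is a fin_num -> y != x ->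
    0 < bregman f x g y + 1 / 2 * sqnorm M (y - x)) ->
  0 < e ->
  exists d : R, 0 < d /\ forall y, f y \is a fin_num ->
    e <= dot (y - x) (y - x) ->
    d * Num.sqrt (dot (y - x) (y - x)) <=
      bregman f x g y + 1 / 2 * sqnorm M (y - x).
Proof.
move=> cpf pM gx xuniq e0.
have [d [d0 dP]] := bregman_sphere cpf gx xuniq e0.
have [_ pf cf] := cpf.
have fx := subdifferential_fin pf gx.
have se0 : 0 < Num.sqrt e by rewrite sqrtr_gt0.
exists (d / Num.sqrt e); split; first exact: divr_gt0.
move=> y fy ey; set w := dot (y - x) (y - x) in ey *.
have w0 : 0 < w by exact: lt_le_trans ey.
have sw0 : 0 < Num.sqrt w by rewrite sqrtr_gt0.
(* This [t] pulls [y] back along the segment to the sphere of squared radius [e] around [x]. *)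
pose t := Num.sqrt e / Num.sqrt w.
have t0 : 0 < t by exact: divr_gt0.
have t1 : t <= 1 by rewrite ler_pdivrMr// mul1r ler_wsqrtr.
have [fp fple] := @convex_fin _ _ f x y t pf cf fx fy (introT andP (conj (ltW t0) t1)).
have tw : t * (t * w) = e.
  by rewrite mulrA -expr2 expr_div_n !sqr_sqrtr ?ltW// divfK// gt_eqF.
have := dP _ fp; rewrite /bregman [x + _ - x]addrAC subrr add0r.
rewrite !dotZl !dotZr sqnormZ -/w => /(_ tw) h.
have M0 := pM.2 (y - x).
(* The Bregman part scales by at most [t] by convexity; the quadratic part scales by [t ^+ 2], which
   is at most [t]. *)
have {}h : d <= t * (bregman f x g y + 1 / 2 * sqnorm M (y - x)).
  apply: le_trans h _; rewrite /bregman.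
  have : t ^+ 2 * sqnorm M (y - x) <= t * sqnorm M (y - x).
    by rewrite expr2 -mulrA ler_piMl// mulr_ge0// ltW.
  by lra.
rewrite -(ler_pM2l t0); apply: le_trans h.
by rewrite le_eqVlt /t; apply/orP; left; apply/eqP; field; rewrite !gt_eqF.
Qed.

(* Compactness of the unit sphere. *)
Lemma posdefmx_dominates (D B : 'M[R]_n) : posdefmx D ->
  exists K : R, 0 < K /\ forall z, sqnorm B z <= K * sqnorm D z.
Proof.
move=> [_ pD]; apply: contrapT => nK.
have /choice[q qP] : forall k : nat, exists q : 'cV[R]_n,
    dot q q = 1 /\ sqnorm D q <= harmonic k * sqnorm B q.
  (* If [K = k + 1] fails at [z], normalising [z] gives [q], as [harmonic k] is the inverse of
     [k + 1]. *)
  move=> k; apply: contrapT => nq; apply: nK; exists k.+1%:R.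
  split=> [|z]; first by rewrite ltr0n.
  rewrite leNgt; apply/negP => zk; apply: nq.
  have z0 : z != 0 by apply: contraTneq zk => ->; rewrite !sqnorm0 mulr0 ltxx.
  have w0 := dotvv_gt0 z0.
  exists ((Num.sqrt (dot z z))^-1 *: z); split.
    by rewrite !dot_lin mulrA -expr2 exprVn sqr_sqrtr ?ltW// mulVf// gt_eqF.
  rewrite !sqnormZ mulrCA ler_pM2l ?exprn_gt0 ?invr_gt0 ?sqrtr_gt0//.
  by rewrite ler_pdivlMl ?ltr0n// ltW.
have [U [UU Uoo]] := ultra_infty.
have [l ql] : exists l : 'cV[R]_n, q @ U --> l.
  apply: (@ultra_cvg_bounded _ _ _ _ _ 1) => //.
  by apply: filterE => k; have [-> _] := qP k.
have l1 : dot l l = 1.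
  have : dot (q k) (q k) @[k --> U] --> dot l l by exact: cvg_dot.
  have -> : (fun k => dot (q k) (q k)) = fun=> 1.
    by apply/funext => k; have [->] := qP k.
  by move/cvg_unique; apply => //; exact: cvg_cst.
have qD : sqnorm D (q k) @[k --> U] --> sqnorm D l by exact: cvg_sqnorm.
have qB : harmonic k * sqnorm B (q k) @[k --> U] --> 0 * sqnorm B l.
  apply: cvgM; last exact: cvg_sqnorm.
  by move=> A /cvg_harmonic /Uoo.
have : sqnorm D l <= 0 * sqnorm B l.
  by apply: ler_cvg_to qD qB _; apply: filterE => k; have [_] := qP k.
rewrite mul0r leNgt pD//; apply: contraTneq (ltr01 : (0:R) < 1) => l0.
by rewrite -l1 l0 dot0l ltxx.
Qed.

End Growth.

(** * One step of the method *)

Section Descent.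
Context {R : realType} {N m : nat} {n : 'I_N -> nat}.
Variables (A : forall i, 'M[R]_(m, n i)) (c : 'cV[R]_m).
Variable f : forall i, 'cV[R]_(n i) -> \bar R.
Arguments f : clear implicits.
Variables rho gamma : R.
Hypotheses (rho0 : 0 < rho) (gamma0 : 0 < gamma).
Hypothesis cpf : forall i, closed_proper_convex (f i).
Implicit Types (P : forall i, 'M[R]_(n i)) (u v w : iterate R N m n).

(** A diagonal block of [Gx], and also the Hessian of the smooth part of the [i]-th subproblem. *)
Definition proxmx P i : 'M[R]_(n i) := P i + rho *: ((A i)^T *m A i).

Definition residual u : 'cV[R]_m := \sum_i A i *m u.1 i - c.

Lemma proxmx_psd P i : psdmx (P i) -> psdmx (proxmx P i).
Proof.
move=> [sP pP]; split.
  by rewrite /proxmx linearD linearZ /= trmx_mul trmxK sP.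
move=> z; rewrite sqnorm_addl sqnorm_scalel sqnorm_gram.
by rewrite addr_ge0// mulr_ge0 ?dotvv_ge0// ltW.
Qed.

Lemma sqnorm_Gx P x y : sqnorm (Gx A rho P) (stackx x - stackx y) =
  \sum_i sqnorm (proxmx P i) (x i - y i).
Proof.
rewrite /stackx -mxcolB sqnormE /Gx mul_mxdiag_mxcol /dot tr_mxcol mul_mxrow_mxcol.
by rewrite summxE; apply: eq_bigr => i _; rewrite sqnormE.
Qed.

Lemma sqnorm_G P u v : sqnorm (G A rho gamma P) (stack u - stack v) =
  \sum_i sqnorm (proxmx P i) (u.1 i - v.1 i) +
  (gamma * rho)^-1 * dot (u.2 - v.2) (u.2 - v.2).
Proof.
rewrite /stack opp_col_mx add_col_mx sqnormE /G mul_block_col !mul0mx addr0 add0r.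
rewrite /dot tr_col_mx mul_row_col mxE mul_scalar_mx -scalemxAr [in X in _ + X]mxE.
by rewrite mulmxA -/(sqnorm _ _) sqnorm_Gx.
Qed.

Lemma hE P u v : h A rho gamma P u v =
  \sum_i sqnorm (proxmx P i) (u.1 i - v.1 i) +
  (2 - gamma) / (rho * gamma ^+ 2) * dot (u.2 - v.2) (u.2 - v.2) +
  2 / gamma * \sum_i dot (u.2 - v.2) (A i *m (u.1 i - v.1 i)).
Proof.
rewrite /h sqnorm_Gx sqnorm1 -dot_sumr; congr (_ + _ * _).
by rewrite -mulmxA /stackx -mxcolB /rowA mul_mxrow_mxcol.
Qed.

Lemma sqnorm_G_ge0 P u v : (forall i, psdmx (P i)) ->
  0 <= sqnorm (G A rho gamma P) (stack u - stack v).
Proof.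
move=> pP; rewrite sqnorm_G addr_ge0//.
  by rewrite sumr_ge0// => i _; exact: (proxmx_psd (pP i)).2.
by rewrite mulr_ge0 ?dotvv_ge0// invr_ge0 ltW// mulr_gt0.
Qed.

Definition prox_term P u i (z : 'cV[R]_(n i)) : R :=
  let r := A i *m z + \sum_(j | j != i) A j *m u.1 j - c - rho^-1 *: u.2 in
  rho / 2 * sqnorm 1%:M r + 1 / 2 * sqnorm (P i) (z - u.1 i).

Lemma subproblemE P u i (z : 'cV[R]_(n i)) :
  subproblem A c f rho P u z = (f i z + (prox_term P u z)%:E)%E.
Proof. by []. Qed.

(** Exact Taylor expansion of a quadratic at [y]. The gradient takes this form because replacing
    block [i] of [u] by [x] turns the residual into [residual u + A i *m (x - u.1 i)]. *)
Lemma prox_term_expand P u i (y z : 'cV[R]_(n i)) : psdmx (P i) ->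
  prox_term P u z = prox_term P u y
    + dot (proxmx P i *m (y - u.1 i) + (A i)^T *m (rho *: residual u - u.2)) (z - y)
    + 1 / 2 * sqnorm (proxmx P i) (z - y).
Proof.
move=> [sP _]; rewrite /prox_term !sqnorm1.
set S := \sum_(j | j != i) _.
have rE x : A i *m x + S - c - rho^-1 *: u.2
    = A i *m (x - u.1 i) + (residual u - rho^-1 *: u.2).
  rewrite /residual (bigD1 i)//= -/S mulmxBr.
  by apply/matrixP => a b; rewrite !mxE; ring.
rewrite !rE; set b := residual u - rho^-1 *: u.2.
set d := z - y; set e := y - u.1 i.
have -> : z - u.1 i = e + d by rewrite /d /e [RHS]addrC addrA subrK.
have -> : rho *: residual u - u.2 = rho *: b.
  by rewrite /b [RHS]scalerBr scalerA divff ?scale1r// gt_eqF.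
clearbody b d e; rewrite sqnorm_add// [sqnorm (proxmx _ _) d]sqnorm_addl.
rewrite sqnorm_scalel sqnorm_gram /proxmx mulmxDl -scalemxAl -mulmxA -scalemxAr.
rewrite mulmxDr !dotDl !dotZl ![dot ((A i)^T *m _) d]dot_mulmxl trmxK.
rewrite (dot_mulmxl (P i)) sP !dotDr.
rewrite (dotC (A i *m d) (A i *m e)) (dotC b (A i *m e)) (dotC (A i *m d) b).
by field.
Qed.

(** First-order optimality: the negative gradient of [prox_term] at the minimiser is a
    subgradient. *)
Lemma admm_step_subdifferential P u v i : psdmx (P i) ->
  admm_step A c f rho gamma P u v ->
  subdifferential (f i) (v.1 i)
    ((A i)^T *m (u.2 - rho *: residual u) - proxmx P i *m (v.1 i - u.1 i)).
Proof.
move=> pP [vmin _]; have [_ pf cf] := cpf i.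
have {}vmin : argmin (subproblem A c f rho P u (i := i)) (v.1 i) by rewrite vmin.
apply: (@minimizer_subdifferential _ _ _ (proxmx P i)) => // y.
have := vmin y; rewrite !subproblemE (prox_term_expand u (v.1 i) y pP).
set g := dot _ _; set q := 1 / 2 * _; set p := prox_term _ _ _.
have -> : dot ((A i)^T *m (u.2 - rho *: residual u) - proxmx P i *m (v.1 i - u.1 i))
    (y - v.1 i) = - g.
  by rewrite /g -dotNl opprD [in RHS]addrC -[- ((A i)^T *m _)]mulmxN opprB.
have [fN _] := pf; move: (fN (v.1 i)) (fN y).
case: (f i (v.1 i)) => [a||]//; case: (f i y) => [b||]//.
  by move=> _ _; rewrite -!EFinD !lee_fin; lra.
by move=> _ _ _; rewrite addye// leey.
Qed.

Lemma kkt_residual w : kkt_point A c f w -> residual w = 0.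
Proof. by move=> [_ wc]; rewrite /residual wc subrr. Qed.

Lemma kkt_fin w i : kkt_point A c f w -> f i (w.1 i) \is a fin_num.
Proof.
by move=> [wf _]; have [_ pf _] := cpf i; exact: subdifferential_fin (wf i).
Qed.

(** At a KKT point the residual vanishes and the gradient of [prox_term] at [w.1 i] is minus the
    subgradient, so the linear term merges with [f i] into the Bregman distance. *)
Lemma kkt_subproblem P w i y : psdmx (P i) -> kkt_point A c f w ->
  f i y \is a fin_num ->
  fine (subproblem A c f rho P w y) = fine (f i (w.1 i)) + prox_term P w (w.1 i)
    + (bregman (f i) (w.1 i) ((A i)^T *m w.2) y
       + 1 / 2 * sqnorm (proxmx P i) (y - w.1 i)).
Proof.
move=> pP kw fy; rewrite subproblemE (prox_term_expand w (w.1 i) y pP).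
rewrite (kkt_residual kw) subrr mulmx0 scaler0 !add0r mulmxN dotNl.
by rewrite -(fineK fy) -EFinD /bregman /=; ring.
Qed.

Lemma kkt_argmin P w i : psdmx (P i) -> kkt_point A c f w ->
  argmin (subproblem A c f rho P w (i := i)) (w.1 i).
Proof.
move=> pP kw y; have [_ pf _] := cpf i.
have fw := kkt_fin i kw.
have [fy|fy] := boolP (f i y \is a fin_num); last first.
  rewrite [leRHS]subproblemE.
  have -> : f i y = +oo%E by case: (f i y) (pf.1 y) fy.
  by rewrite addye// leey.
have sfin z : f i z \is a fin_num -> subproblem A c f rho P w z \is a fin_num.
  by move=> fz; rewrite subproblemE fin_numD fz.
rewrite -(fineK (sfin _ fw)) -(fineK (sfin _ fy)) lee_fin.
rewrite !kkt_subproblem// lerD2l /bregman subrr subrr dot0r subrr sqnorm0 mulr0 addr0.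
rewrite addr_ge0//; first exact: bregman_ge0 (kw.1 i) fy.
by rewrite mulr_ge0// (proxmx_psd pP).2.
Qed.

(** By [kkt_subproblem] this quantity is the excess over the minimal value; were it nonpositive, [y]
    would be a second minimiser of a subproblem that has exactly one. *)
Lemma kkt_unique P w i y : psdmx (P i) -> well_posed A c f rho P ->
  kkt_point A c f w -> f i y \is a fin_num -> y != w.1 i ->
  0 < bregman (f i) (w.1 i) ((A i)^T *m w.2) y
      + 1 / 2 * sqnorm (proxmx P i) (y - w.1 i).
Proof.
move=> pP wP kw fy yw; rewrite ltNge; apply/negP => le0.
have [z zP] := wP w i.
have wmin := kkt_argmin pP kw.
have : argmin (subproblem A c f rho P w (i := i)) y.
  move=> t; apply: le_trans (wmin t); have fw := kkt_fin i kw.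
  have sfin x : f i x \is a fin_num -> subproblem A c f rho P w x \is a fin_num.
    by move=> fx; rewrite subproblemE fin_numD fx.
  rewrite -(fineK (sfin _ fw)) -(fineK (sfin _ fy)) lee_fin.
  by rewrite !kkt_subproblem// lerD2l /bregman !subrr dot0r subrr sqnorm0 mulr0 addr0.
move: wmin; rewrite zP => /= wz yz; by rewrite yz wz eqxx in yw.
Qed.

Lemma admm_step_fin P u v i : psdmx (P i) ->
  admm_step A c f rho gamma P u v -> f i (v.1 i) \is a fin_num.
Proof.
move=> pP /(admm_step_subdifferential pP); have [_ pf _] := cpf i.
exact: subdifferential_fin.
Qed.

Lemma admm_step_residual P u v : admm_step A c f rho gamma P u v ->
  residual v = (gamma * rho)^-1 *: (u.2 - v.2).
Proof.
move=> [_ ->]; rewrite -/(residual v) opprB addrC subrK scalerA mulVf ?scale1r//.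
by rewrite mulf_neq0// gt_eqF.
Qed.

(** The subgradients at [v] are tested at [w]. They involve the residual of [u]; expressing it by
    that of [v], which is proportional to the change of the multiplier, produces the cross term of
    [h]. *)
Lemma descent P u v w : (forall i, psdmx (P i)) -> kkt_point A c f w ->
  admm_step A c f rho gamma P u v ->
  2 * \sum_i bregman (f i) (w.1 i) ((A i)^T *m w.2) (v.1 i) + h A rho gamma P u v <=
    sqnorm (G A rho gamma P) (stack u - stack w)
    - sqnorm (G A rho gamma P) (stack v - stack w).
Proof.
move=> pP kw st.
(* Adding the subgradient inequality at [v.1 i] cancels the values of [f i]. *)
have bi i : bregman (f i) (w.1 i) ((A i)^T *m w.2) (v.1 i) <=
    dot (u.2 - w.2 - rho *: residual u) (A i *m (v.1 i - w.1 i))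
    + dot (u.1 i - v.1 i) (proxmx P i *m (v.1 i - w.1 i)).
  have [_ pf _] := cpf i; have fw := kkt_fin i kw.
  have fv := admm_step_fin (pP i) st.
  have := bregman_ge0 pf (admm_step_subdifferential (pP i) st) fw.
  rewrite /bregman.
  have [sM _] := proxmx_psd (pP i).
  rewrite [dot (_ - _ - _) _]dot_mulmxr [dot (_ - _) (proxmx _ _ *m _)]dot_mulmxr sM.
  rewrite -(opprB (v.1 i) (w.1 i)) -(opprB (v.1 i) (u.1 i)) !mulmxN !mulmxBr !dot_lin.
  by lra.
have /= := @ler_sum _ 'I_N (index_enum 'I_N) xpredT _ _ (fun i _ => bi i).
rewrite [X in _ <= X -> _]big_split/= -dot_sumr.
have -> : \sum_i A i *m (v.1 i - w.1 i) = (gamma * rho)^-1 *: (u.2 - v.2).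
  rewrite -(admm_step_residual st) /residual -kw.2 -sumrB.
  by apply: eq_bigr => i _; rewrite mulmxBr.
have -> : residual u = \sum_i A i *m (u.1 i - v.1 i) + (gamma * rho)^-1 *: (u.2 - v.2).
  rewrite -(admm_step_residual st) /residual addrA -big_split/=; congr (_ - _).
  by apply: eq_bigr => i _; rewrite -mulmxDr subrK.
rewrite hE !sqnorm_G -dot_sumr.
set a := \sum_i A i *m _; set dl := u.2 - v.2; set B := \sum_i bregman _ _ _ _.
have -> : u.2 - w.2 = dl + (v.2 - w.2) by rewrite addrA subrK.
have sq i : sqnorm (proxmx P i) (u.1 i - w.1 i) =
    sqnorm (proxmx P i) (u.1 i - v.1 i)
    + 2 * dot (u.1 i - v.1 i) (proxmx P i *m (v.1 i - w.1 i))
    + sqnorm (proxmx P i) (v.1 i - w.1 i).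
  rewrite -sqnorm_add; last by have [] := proxmx_psd (pP i).
  by rewrite addrA subrK.
under [X in _ <= X + _ - _]eq_bigr do rewrite sq.
rewrite !big_split/= -mulr_sumr.
set X := \sum_i dot _ _; set e := v.2 - w.2.
have gr : gamma * rho != 0 by rewrite mulf_neq0// gt_eqF.
have gn0 : gamma != 0 by rewrite gt_eqF.
have rn0 : rho != 0 by rewrite gt_eqF.
clearbody a dl e X B; rewrite !dot_lin.
rewrite (dotC dl e) (dotC dl a).
move=> H; rewrite -subr_ge0.
(* The two sides of the goal differ by exactly twice the gap in the summed inequality, so only an
   identity remains. *)
match type of H with
| is_true (_ <= ?r) =>
    have H2 : 0 <= 2 * (r - B) by rewrite mulr_ge0// subr_ge0
end.
apply: le_trans H2 _; rewrite le_eqVlt; apply/orP; left; apply/eqP.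
by field; rewrite ?gn0 ?rn0.
Qed.

End Descent.

(** * Accepted and rejected steps *)

Section Convergence.
Context {R : realType} {N m : nat} {n : 'I_N -> nat}.
Variables (A : forall i, 'M[R]_(m, n i)) (c : 'cV[R]_m).
Variable f : forall i, 'cV[R]_(n i) -> \bar R.
Arguments f : clear implicits.
Variables rho gamma eta : R.
Hypotheses (rho0 : 0 < rho) (gamma0 : 0 < gamma) (eta0 : 0 < eta).
Hypothesis cpf : forall i, closed_proper_convex (f i).
Implicit Types (P : forall i, 'M[R]_(n i)) (u v w : iterate R N m n).

(** By the bound on [eta], only the cross term of [h - eta ||u - v||_G^2] can be negative. Young's
    inequality absorbs it into the multiplier term and into [||A i dx i||^2], which a multiple of
    [D i] dominates. A positive definite form in [u - v] is left, and rejection makes it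
    nonpositive. *)
Lemma rejected_trivial (D : forall i, 'M[R]_(n i)) :
  (0 < N)%N -> eta < Num.min 1 (2 / gamma - 1) ->
  (forall i, posdefmx (D i)) ->
  exists K : R, forall P,
    (forall i z, K * sqnorm (D i) z <= sqnorm (P i) z) ->
    forall u v, ~ accept A rho gamma eta P u v -> u = v.
Proof.
move=> N0; rewrite lt_min => /andP[eta1 eta2] pD.
have gn0 : gamma != 0 by rewrite gt_eqF.
have rn0 : rho != 0 by rewrite gt_eqF.
have NR : 0 < N%:R :> R by rewrite ltr0n.
(* The coefficient of [dot dl dl] in [h] after subtracting [eta] times its share of the squared
   [G]-norm. *)
pose a := (2 / gamma - 1 - eta) / (gamma * rho).
have a0 : 0 < a by rewrite divr_gt0// ?mulr_gt0//; lra.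
(* The Young constant when each of the [N] cross terms takes [a / (2 N)] of the multiplier term, so
   that [a / 2] survives. *)
pose kap := 2 * N%:R / (a * gamma ^+ 2).
have kap0 : 0 < kap by apply: divr_gt0; apply: mulr_gt0 => //; exact: exprn_gt0.
have /choice[k kP] i := posdefmx_dominates ((A i)^T *m A i) (pD i).
have k0 i : 0 < k i := (kP i).1.
(* The sum bounds every [k i] at once, and the summand 1 leaves one copy of each [D i] in the
   end. *)
exists ((kap * \sum_i k i + 1) / (1 - eta)) => P PK u v /negP; rewrite -leNgt.
rewrite hE sqnorm_G => le0.
set dl := u.2 - v.2 in le0; pose dx i := u.1 i - v.1 i.
have D0 i z : 0 <= sqnorm (D i) z.
  have [->|z0] := eqVneq z 0; first by rewrite sqnorm0.
  by rewrite ltW// (pD i).2.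
have term i : sqnorm (D i) (dx i) <= (1 - eta) * sqnorm (proxmx A rho P i) (dx i)
   + a / (2 * N%:R) * dot dl dl + 2 / gamma * dot dl (A i *m dx i).
  have h1 := PK i (dx i).
  have h2 : (kap * \sum_i k i + 1) * sqnorm (D i) (dx i) <=
      (1 - eta) * sqnorm (P i) (dx i).
    by rewrite -ler_pdivrMl; [rewrite mulrA [_^-1 * _]mulrC|lra].
  have h3 : (1 - eta) * sqnorm (P i) (dx i) <=
      (1 - eta) * sqnorm (proxmx A rho P i) (dx i).
    rewrite ler_pM2l; last lra.
    by rewrite sqnorm_addl sqnorm_scalel sqnorm_gram lerDl mulr_ge0 ?dotvv_ge0// ltW.
  have h4 : kap * dot (A i *m dx i) (A i *m dx i) <=
      kap * ((\sum_i k i) * sqnorm (D i) (dx i)).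
    rewrite ler_pM2l// -sqnorm_gram; apply: le_trans ((kP i).2 _) _.
    rewrite ler_wpM2r// (bigD1 i)//= lerDl sumr_ge0// => j _; exact: ltW.
  have h5 : 0 <= a / (2 * N%:R) * dot dl dl + 2 / gamma * dot dl (A i *m dx i)
      + kap * dot (A i *m dx i) (A i *m dx i).
    (* This square, scaled by [a / (2 N)], is exactly the expression in the claim. *)
    have := dotvv_ge0 (dl + (2 * N%:R / (a * gamma)) *: (A i *m dx i)).
    rewrite -(pmulr_rge0 _ (_ : 0 < a / (2 * N%:R))); last by rewrite divr_gt0// mulr_gt0.
    rewrite dot_sqrDZ.
    set s := dot _ _; set t := dot _ _; set r := dot _ _ => h.
    apply: le_trans h _; rewrite le_eqVlt; apply/orP; left; apply/eqP.
    by rewrite /kap; field; rewrite gn0 !gt_eqF.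
  by lra.
have sum := @ler_sum _ _ (index_enum 'I_N) xpredT _ _ (fun i _ => term i).
have {sum} total : \sum_i sqnorm (D i) (dx i) + a / 2 * dot dl dl <= 0.
  move: sum => /=; rewrite !big_split/= -!mulr_sumr sumr_const card_ord.
  rewrite -[dot dl dl *+ N]mulr_natl => sum.
  have e1 : a / (2 * N%:R) * (N%:R * dot dl dl) = a / 2 * dot dl dl.
    by field; rewrite gt_eqF.
  have e2 : (2 - gamma) / (rho * gamma ^+ 2) * dot dl dl =
      a * dot dl dl + eta * ((gamma * rho)^-1 * dot dl dl).
    by rewrite /a; field; rewrite gn0 rn0.
  move: le0; rewrite e2 -/dl; move: sum; rewrite e1 /dx; lra.
have sD0 : 0 <= \sum_i sqnorm (D i) (dx i) by rewrite sumr_ge0.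
have dl0 : 0 <= dot dl dl by exact: dotvv_ge0.
have adl0 : 0 <= a / 2 * dot dl dl by rewrite mulr_ge0// ltW// divr_gt0.
have udx i : dx i = 0.
  apply/eqP/negPn/negP => di; have := (pD i).2 _ di.
  have : sqnorm (D i) (dx i) <= \sum_i sqnorm (D i) (dx i).
    by rewrite [leRHS](bigD1 i)//= lerDl sumr_ge0.
  by lra.
have udl : dl = 0.
  apply: dotvv_eq0; apply/eqP; rewrite eq_le dl0 andbT.
  have : a / 2 * dot dl dl <= 0 by lra.
  by rewrite pmulr_rle0// divr_gt0.
rewrite [u]surjective_pairing [v]surjective_pairing; congr pair.
  apply: functional_extensionality_dep => i; apply/eqP.
  by rewrite -subr_eq0 -/(dx i) udx.
by apply/eqP; rewrite -subr_eq0 -/dl udl.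
Qed.

Lemma fixed_point_kkt P u : (forall i, psdmx (P i)) ->
  admm_step A c f rho gamma P u u -> kkt_point A c f u.
Proof.
move=> pP st; have := admm_step_residual rho0 gamma0 st.
rewrite subrr scaler0 => r0; split; last first.
  by apply/eqP; rewrite -subr_eq0 -/(residual A c u) r0.
move=> i; have := admm_step_subdifferential rho0 cpf (pP i) st.
by rewrite r0 scaler0 subr0 subrr mulmx0 subr0.
Qed.

Lemma kkt_fixed_point P u v : (forall i, psdmx (P i)) -> kkt_point A c f u ->
  admm_step A c f rho gamma P u v -> v = u.
Proof.
move=> pP ku [v1 v2].
have vu i : v.1 i = u.1 i.
  by have := kkt_argmin rho0 cpf (pP i) ku; rewrite v1 => /= ->.
rewrite [u]surjective_pairing [v]surjective_pairing; congr pair.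
  exact: functional_extensionality_dep.
rewrite v2; under eq_bigr do rewrite vu.
by rewrite -/(residual A c u) (kkt_residual ku) scaler0 subr0.
Qed.

(** * Accepted steps with fixed matrices *)

Section AcceptedSteps.
Variables (P0 P : forall i, 'M[R]_(n i)) (u : nat -> iterate R N m n).
Hypotheses (pP0 : forall i, psdmx (P0 i)) (pP : forall i, psdmx (P i)).
Hypothesis P0P : forall i z, sqnorm (P0 i) z <= sqnorm (P i) z.
Hypothesis wP0 : well_posed A c f rho P0.
Hypothesis step : forall k, admm_step A c f rho gamma P (u k) (u k.+1).
Hypothesis acc : forall k, accept A rho gamma eta P (u k) (u k.+1).

Let E w k := sqnorm (G A rho gamma P) (stack (u k) - stack w).
Let S k := sqnorm (G A rho gamma P) (stack (u k) - stack (u k.+1)).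

Let E_ge0 w k : 0 <= E w k.
Proof. exact: sqnorm_G_ge0. Qed.

Let S_ge0 k : 0 <= S k.
Proof. exact: sqnorm_G_ge0. Qed.

(** Formed with [P0], for which well-posedness is assumed; [P] dominates [P0], so [E] still controls
    it. *)
Let phi w k i : R := bregman (f i) (w.1 i) ((A i)^T *m w.2) ((u k).1 i)
  + 1 / 2 * sqnorm (proxmx A rho P0 i) ((u k).1 i - w.1 i).

Let phi_breg_ge0 w k i : kkt_point A c f w ->
  0 <= bregman (f i) (w.1 i) ((A i)^T *m w.2) ((u k.+1).1 i).
Proof.
move=> kw; have [_ pf _] := cpf i; apply: bregman_ge0 (kw.1 i) _ => //.
exact: admm_step_fin (step k).
Qed.

Let E_decr w k : kkt_point A c f w -> E w k.+1 + eta * S k <= E w k.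
Proof.
move=> kw; have := descent rho0 gamma0 cpf pP kw (step k).
have : 0 <= \sum_i bregman (f i) (w.1 i) ((A i)^T *m w.2) ((u k.+1).1 i).
  by rewrite sumr_ge0// => i _; exact: phi_breg_ge0.
have := acc k; rewrite /accept /E /S; lra.
Qed.

Let E_mono w : kkt_point A c f w -> nonincreasing_seq (E w).
Proof.
move=> kw; apply/nonincreasing_seqP => k; apply: le_trans (E_decr k kw).
by rewrite lerDl mulr_ge0// ltW.
Qed.

(** Half of [E w k] pays for each summand: [descent] for the Bregman distance, monotonicity of [E]
    for the quadratic. At index [k.+1] the point comes from a step, so [f i] is finite there. *)
Let phi_le w k i : kkt_point A c f w -> phi w k.+1 i <= E w k.
Proof.
move=> kw; rewrite /phi.
have h1 : 2 * bregman (f i) (w.1 i) ((A i)^T *m w.2) ((u k.+1).1 i) <= E w k.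
  have := descent rho0 gamma0 cpf pP kw (step k).
  have : bregman (f i) (w.1 i) ((A i)^T *m w.2) ((u k.+1).1 i) <=
     \sum_i bregman (f i) (w.1 i) ((A i)^T *m w.2) ((u k.+1).1 i).
    rewrite [leRHS](bigD1 i)//= lerDl sumr_ge0// => j _; exact: phi_breg_ge0.
  have := acc k; rewrite /accept -/(S k) -/(E w k) -/(E w k.+1).
  have := E_ge0 w k.+1; have : 0 <= eta * S k by rewrite mulr_ge0// ltW.
  by lra.
have h2 : sqnorm (proxmx A rho P0 i) ((u k.+1).1 i - w.1 i) <= E w k.
  apply: le_trans (E_mono kw (leqnSn k)).
  rewrite /E sqnorm_G -[leLHS]addr0 lerD//; last first.
    by rewrite mulr_ge0 ?dotvv_ge0// invr_ge0 ltW// mulr_gt0.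
  rewrite (bigD1 i)//= -[leLHS]addr0 lerD//.
    by rewrite /proxmx !sqnorm_addl lerD2r.
  by rewrite sumr_ge0// => j _; exact: (proxmx_psd A rho0 (pP j)).2.
by lra.
Qed.

Let lambda_le w k : dot ((u k).2 - w.2) ((u k).2 - w.2) <= gamma * rho * E w k.
Proof.
rewrite /E sqnorm_G mulrDr mulVKf; last by rewrite mulf_neq0// gt_eqF.
rewrite lerDr mulr_ge0//; first by rewrite mulr_ge0// ltW.
by rewrite sumr_ge0// => j _; exact: (proxmx_psd A rho0 (pP j)).2.
Qed.

Let growth w i (e : R) : kkt_point A c f w -> 0 < e ->
  exists d : R, 0 < d /\ forall k,
    e <= dot ((u k.+1).1 i - w.1 i) ((u k.+1).1 i - w.1 i) ->
    d * Num.sqrt (dot ((u k.+1).1 i - w.1 i) ((u k.+1).1 i - w.1 i)) <= E w k.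
Proof.
move=> kw e0.
have [d [d0 dP]] := bregman_growth (cpf i) (proxmx_psd A rho0 (pP0 i)) (kw.1 i)
  (fun y fy yw => kkt_unique rho0 cpf (pP0 i) wP0 kw fy yw) e0.
exists d; split=> // k ek; apply: le_trans (phi_le k i kw).
by apply: dP => //; exact: admm_step_fin (step k).
Qed.

Let x_bounded w i : kkt_point A c f w -> exists B : R,
  forall k, dot ((u k.+1).1 i - w.1 i) ((u k.+1).1 i - w.1 i) <= B.
Proof.
move=> kw; have [d [d0 dP]] := growth i kw ltr01.
(* Beyond distance 1, [growth] gives [d * sqrt z <= E w 0]. *)
exists (Num.max 1 ((E w 0 / d) ^+ 2)) => k; rewrite le_max.
set z := dot _ _; have [//|/ltW z1] := leP z 1; apply/orP; right.
have z0 : 0 <= z by exact: dotvv_ge0.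
have Ek : E w k <= E w 0 by exact: E_mono.
rewrite -[leLHS]sqr_sqrtr// ler_pXn2r ?nnegrE ?sqrtr_ge0//; last first.
  by rewrite divr_ge0// ltW.
by rewrite ler_pdivlMr// mulrC (le_trans (dP k z1)).
Qed.

(** [eta * S k] is at most the decrease of the convergent sequence [E w]. *)
Let S_cvg0 w : kkt_point A c f w -> S @ \oo --> (0 : R).
Proof.
move=> kw.
have Ec : cvgn (E w).
  apply: nonincreasing_is_cvgn; first exact: E_mono.
  by exists 0 => _ [k _ <-].
have dE : (fun k => eta^-1 * (E w k - E w k.+1)) @ \oo --> (0 : R).
  rewrite -[X in _ --> X](mulr0 eta^-1); apply: cvgM; first exact: cvg_cst.
  rewrite -[X in _ --> X](subrr (limn (E w))); apply: cvgB => //.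
  by rewrite cvg_shiftS.
apply: squeeze_cvgr (cvg_cst 0) dE; apply: filterE => k /=.
by rewrite S_ge0 ler_pdivlMl//; have := E_decr k kw; lra.
Qed.

Let cvg_sqnorm_G (U : set_system nat) (v w : nat -> iterate R N m n)
    (vl wl : iterate R N m n) :
  ProperFilter U ->
  (forall i, (fun k => (v k).1 i) @ U --> vl.1 i) -> (fun k => (v k).2) @ U --> vl.2 ->
  (forall i, (fun k => (w k).1 i) @ U --> wl.1 i) -> (fun k => (w k).2) @ U --> wl.2 ->
  (fun k => sqnorm (G A rho gamma P) (stack (v k) - stack (w k))) @ U -->
    sqnorm (G A rho gamma P) (stack vl - stack wl).
Proof.
move=> PU v1 v2 w1 w2; rewrite sqnorm_G; under eq_cvg do rewrite sqnorm_G.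
apply: cvgD.
  by apply: cvg_sumr => i; apply: cvg_sqnorm; exact: cvgB (v1 i) (w1 i).
by apply: cvgM; [exact: cvg_cst|apply: cvg_dot; exact: cvgB].
Qed.

(** Consecutive iterates have limits [ub 0] and [ub 1] along [U], whose difference is only known to
    have zero [G]-seminorm. The multipliers and the products with [A i] then agree and the proximal
    terms vanish, which is enough for [ub 1] to be a KKT point. *)
Let cluster_point w : kkt_point A c f w ->
  exists (U : set_system nat) (v : iterate R N m n), [/\ UltraFilter U,
    kkt_point A c f v, (forall i, (fun k => (u k.+2).1 i) @ U --> v.1 i)
    & (fun k => (u k.+2).2) @ U --> v.2].
Proof.
move=> kw; have [U [UU Uoo]] := ultra_infty.
have bnd (p : nat) (y : nat -> 'cV[R]_p) (z : 'cV[R]_p) (B : R) :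
    (forall k, dot (y k - z) (y k - z) <= B) -> {l : 'cV[R]_p | y @ U --> l}.
  move=> yB; apply: cid.
  have [l yl] : exists l : 'cV[R]_p, (fun k => y k - z) @ U --> l.
    by apply: (@ultra_cvg_bounded _ _ _ _ _ B) => //; exact: filterE.
  exists (l + z).
  have -> : y = (fun k => y k - z + z) by apply/funext => k; rewrite subrK.
  by apply: cvgD => //; exact: cvg_cst.
(* The bounds hold from the first step on, hence [k.+1]; [j] will be 0 or 1, for the two consecutive
   iterates. *)
have xl j i : {l : 'cV[R]_(n i) | (fun k => (u (k.+1 + j)).1 i) @ U --> l}.
  have [B xB] := cid (x_bounded i kw).
  by apply: (bnd _ _ (w.1 i) B) => k; rewrite addSn.
have ll j : {l : 'cV[R]_m | (fun k => (u (k.+1 + j)).2) @ U --> l}.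
  apply: (bnd _ _ w.2 (gamma * rho * E w 0)) => k.
  apply: le_trans (lambda_le w _) _; rewrite ler_pM2l ?mulr_gt0//.
  exact: E_mono.
pose ub j : iterate R N m n := (fun i => projT1 (xl j i), projT1 (ll j)).
have ub1 j i : (fun k => (u (k.+1 + j)).1 i) @ U --> (ub j).1 i := projT2 (xl j i).
have ub2 j : (fun k => (u (k.+1 + j)).2) @ U --> (ub j).2 := projT2 (ll j).
have addk1 k : (k.+1 + 1 = k.+2)%N by rewrite addn1.
have x0 i : (fun k => (u k.+1).1 i) @ U --> (ub 0).1 i.
  by have := ub1 0%N i; under eq_cvg do rewrite addn0.
have l0 : (fun k => (u k.+1).2) @ U --> (ub 0).2.
  by have := ub2 0%N; under eq_cvg do rewrite addn0.
have x1 i : (fun k => (u k.+2).1 i) @ U --> (ub 1).1 i.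
  by have := ub1 1%N i; under eq_cvg do rewrite addk1.
have l1 : (fun k => (u k.+2).2) @ U --> (ub 1).2.
  by have := ub2 1%N; under eq_cvg do rewrite addk1.
exists U, (ub 1); split=> //.
have G0 : sqnorm (G A rho gamma P) (stack (ub 0) - stack (ub 1)) = 0.
  have c1 : (fun k => S k.+1) @ U -->
     sqnorm (G A rho gamma P) (stack (ub 0) - stack (ub 1)) by exact: cvg_sqnorm_G.
  have c2 : (fun k => S k.+1) @ U --> (0 : R).
    by move=> B B0; apply: Uoo; have := S_cvg0 kw; rewrite -cvg_shiftS; apply.
  exact: cvg_unique c1 c2.
move: G0; rewrite sqnorm_G.
have pr0 i : 0 <= sqnorm (proxmx A rho P i) ((ub 0).1 i - (ub 1).1 i).
  exact: (proxmx_psd A rho0 (pP i)).2.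
have gr0 : 0 < (gamma * rho)^-1 by rewrite invr_gt0 mulr_gt0.
move/eqP; rewrite paddr_eq0; last first.
- by rewrite mulr_ge0 ?dotvv_ge0// ltW.
- by rewrite sumr_ge0.
rewrite psumr_eq0// mulf_eq0 gt_eqF//= => /andP[/allP d0 /eqP/dotvv_eq0 dl0].
have {}d0 i : sqnorm (proxmx A rho P i) ((ub 0).1 i - (ub 1).1 i) = 0.
  by apply/eqP; have := d0 i (mem_index_enum i).
(* Both summands of [proxmx] are nonnegative, so the one from [A i] vanishes as well. *)
have Ad0 i : A i *m ((ub 0).1 i - (ub 1).1 i) = 0.
  apply: dotvv_eq0; apply/eqP; rewrite -sqnorm_gram.
  have := d0 i; rewrite sqnorm_addl sqnorm_scalel => /eqP.
  rewrite paddr_eq0; first by rewrite mulf_eq0 (gt_eqF rho0)/= => /andP[].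
    exact: (pP i).2.
  by rewrite mulr_ge0 ?sqnorm_gram ?dotvv_ge0// ltW.
have res j (x1' : forall i, (fun k => (u (k.+1 + j)).1 i) @ U --> (ub j).1 i) :
    (fun k => residual A c (u (k.+1 + j))) @ U --> residual A c (ub j).
  rewrite /residual; apply: cvgB; last exact: cvg_cst.
  by apply: cvg_summx => i; exact: cvg_mulmxl.
(* By the multiplier update the residual is proportional to the multiplier increment, whose limit is
   zero. *)
have r1 : residual A c (ub 1) = 0.
  have c1 := res 1%N (ub1 1%N).
  have c2 : (fun k => residual A c (u (k.+1 + 1))) @ U -->
      (gamma * rho)^-1 *: ((ub 0).2 - (ub 1).2).
    under eq_cvg do rewrite addk1 (admm_step_residual rho0 gamma0 (step _)).
    by apply: cvgZr; apply: cvgB.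
  have := cvg_unique _ c1 c2; rewrite dl0 scaler0; exact.
have r0 : residual A c (ub 0) = 0.
  rewrite -r1 /residual; congr (_ - _); apply: eq_bigr => i _.
  by apply/eqP; rewrite -subr_eq0 -mulmxBr Ad0.
split; last by apply/eqP; rewrite -subr_eq0 -/(residual A c (ub 1)) r1.
move=> i; have [lf pf _] := cpf i.
(* The added residual and proximal term are zero; with them the vector is the limit of the
   subgradients produced by the steps. *)
have -> : (A i)^T *m (ub 1).2 = (A i)^T *m ((ub 0).2 - rho *: residual A c (ub 0))
    - proxmx A rho P i *m ((ub 1).1 i - (ub 0).1 i).
  rewrite r0 scaler0 subr0 -[(ub 1).1 i - _]opprB mulmxN opprK.
  rewrite (psdmx_kernel (proxmx_psd A rho0 (pP i)) (d0 i)).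
  by rewrite addr0; congr (_ *m _); apply/eqP; rewrite eq_sym -subr_eq0 dl0.
apply: (@subdifferential_closed _ _ _ _ U (fun k => (u k.+2).1 i)
  (fun k => (A i)^T *m ((u k.+1).2 - rho *: residual A c (u k.+1))
    - proxmx A rho P i *m ((u k.+2).1 i - (u k.+1).1 i))) => //.
  apply: cvgB; last by apply: cvg_mulmxl; exact: cvgB (x1 i) (x0 i).
  apply: cvg_mulmxl; apply: cvgB => //; apply: cvgZr.
  by have := res 0%N (ub1 0%N); under eq_cvg do rewrite addn0.
by move=> k; exact: admm_step_subdifferential (step _).
Qed.

Lemma accepted_steps_converge w : kkt_point A c f w ->
  exists v, kkt_point A c f v /\ converges_to u v.
Proof.
move=> kw; have [U [v [UU kv v1 v2]]] := cluster_point kw.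
exists v; split=> //.
have E0 : (fun k => E v k.+2) @ U --> (0 : R).
  rewrite -[X in _ --> X](_ : sqnorm (G A rho gamma P) (stack v - stack v) = 0).
    by apply: cvg_sqnorm_G => // *; exact: cvg_cst.
  by rewrite subrr sqnorm0.
(* [E v] is nonincreasing, so one small value found along [U] bounds all later ones. *)
have Elt e : 0 < e -> \forall k \near \oo, E v k < e.
  move=> e0; have [k Ek] := filter_ex (cvgr_lt 0 E0 e e0).
  exists k.+2 => // j /= kj; exact: le_lt_trans (E_mono kv kj) Ek.
split=> [i|].
  rewrite -cvg_shiftS; apply: cvg_dot_sub0 => e e0.
  (* A squared distance of at least [e] would force [E] to be at least [d * sqrt e]. *)
  have [d [d0 dP]] := growth i kv e0.
  apply: filterS (Elt (d * Num.sqrt e) _); last by rewrite mulr_gt0// sqrtr_gt0.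
  move=> k Ek /=; rewrite ltNge; apply/negP => ek.
  have := le_lt_trans (dP k ek) Ek; rewrite ltr_pM2l// ltNge => /negP; apply.
  exact: ler_wsqrtr.
apply: cvg_dot_sub0 => e e0.
apply: filterS (Elt (e / (gamma * rho)) _); last by rewrite divr_gt0// mulr_gt0.
move=> k Ek; apply: le_lt_trans (lambda_le v k) _.
by rewrite mulrC -ltr_pdivlMr ?mulr_gt0.
Qed.

End AcceptedSteps.

End Convergence.

(** * Runs of the adaptive scheme *)

Section AdaptiveRun.
Context {R : realType} {N m : nat} {n : 'I_N -> nat}.
Variables (A : forall i, 'M[R]_(m, n i)) (c : 'cV[R]_m).
Variable f : forall i, 'cV[R]_(n i) -> \bar R.
Arguments f : clear implicits.
Variables (rho gamma eta : R) (alpha beta : 'I_N -> R).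
Variables (Q : forall i, 'M[R]_(n i)).
Variables (u : nat -> iterate R N m n) (P : nat -> forall i, 'M[R]_(n i)).
Hypotheses (rho0 : 0 < rho) (gamma0 : 0 < gamma).
Hypothesis cpf : forall i, closed_proper_convex (f i).
Hypothesis alpha1 : forall i, 1 < alpha i.
Hypothesis pP0 : forall i, psdmx (P 0%N i).
Hypothesis run : adaptive_run A c f rho gamma eta alpha beta Q u P.

Definition rejected k : Prop := exists v,
  [/\ admm_step A c f rho gamma (P k) (u k) v,
      ~ accept A rho gamma eta (P k) (u k) v
    & increased alpha beta Q (P k) (P k.+1)].

Lemma run_monoS k i :
  (psdmx (P k i) -> psdmx (P k.+1 i)) /\
  (forall z, sqnorm (P k i) z <= sqnorm (P k.+1 i) z).
Proof.
have [v [_ [[_ [_ ->]]|[_ [_ /(_ i)[_ /posdefmx_psd[sD pD]]]]]]] := run k => //.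
have le z : sqnorm (P k i) z <= sqnorm (P k.+1 i) z.
  by rewrite -subr_ge0 -sqnorm_subl.
split=> // -[sP pP]; split=> [|z]; last exact: le_trans (pP z) (le z).
by rewrite -(subrK (P k i) (P k.+1 i)) linearD/= sD sP.
Qed.

Lemma run_psd k i : psdmx (P k i).
Proof. by elim: k => [|k IH]; [exact: pP0|exact: (run_monoS k i).1]. Qed.

Lemma run_mono k l i z : (k <= l)%N -> sqnorm (P k i) z <= sqnorm (P l i) z.
Proof.
move=> /subnKC <-; elim: (l - k)%N => [|j IH]; first by rewrite addn0.
by rewrite addnS; apply: le_trans IH _; exact: (run_monoS _ i).2.
Qed.

(* An increment [(alpha - 1) P + beta Q] only grows with [P], so every later
   rejection adds at least the increment of the first one. *)
Lemma infinitely_rejected_unbounded :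
  (forall K, exists2 k, (K <= k)%N & rejected k) ->
  exists D : forall i, 'M[R]_(n i), (forall i, posdefmx (D i)) /\
    forall j : nat, exists k, forall i z, j%:R * sqnorm (D i) z <= sqnorm (P k i) z.
Proof.
move=> rej; have [k1 _ [v1 [_ _ inc1]]] := rej 0%N.
exists (fun i => P k1.+1 i - P k1 i); split=> [i|j]; first exact: (inc1 i).2.
suff [k _ kP] : exists2 k, (k1 <= k)%N & forall i z,
    j%:R * sqnorm (P k1.+1 i - P k1 i) z <= sqnorm (P k i) z by exists k.
elim: j => [|j [k k1k IH]].
  by exists k1 => // i z; rewrite mul0r; exact: (run_psd k1 i).2.
have [l kl [v [_ _ inc]]] := rej k; exists l.+1.
  exact: leq_trans k1k (leqW kl).
move=> i z; rewrite -[j.+1]addn1 natrD mulrDl mul1r.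
have := IH i z; have := run_mono z kl.
have := run_mono z (leq_trans k1k kl).
rewrite sqnorm_subl (inc i).1 (inc1 i).1 !sqnorm_addl !sqnorm_scalel.
have a0 : 0 < alpha i - 1 by rewrite subr_gt0.
set x := sqnorm (P k1 i) z; set y := sqnorm (P l i) z => xy.
have : 0 <= (alpha i - 1) * (y - x) by rewrite mulr_ge0 ?subr_ge0// ltW.
lra.
Qed.

(** A tentative step from a KKT point returns that point, so acceptance and rejection both keep
    it. *)
Lemma kkt_iterate_stationary k j : kkt_point A c f (u k) -> u (k + j)%N = u k.
Proof.
move=> ku; elim: j => [|j IH]; first by rewrite addn0.
rewrite addnS; have [v [st [[_ [-> _]]|[_ [-> _]]]]] := run (k + j) => //.
by rewrite IH in st; exact: kkt_fixed_point (run_psd _) ku st.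
Qed.

Lemma infinitely_rejected_converges : (0 < N)%N ->
  eta < Num.min 1 (2 / gamma - 1) ->
  (forall K, exists2 k, (K <= k)%N & rejected k) ->
  exists w, kkt_point A c f w /\ converges_to u w.
Proof.
move=> N0 eta1 rej.
have [D [pD DP]] := infinitely_rejected_unbounded rej.
have [K KP] := rejected_trivial A rho0 gamma0 N0 eta1 pD.
(* [Num.bound] supplies a natural number above the real threshold [K]. *)
have [k kP] := DP (Num.bound `|K|).
have [l kl [v [st nacc _]]] := rej k.
have uv : u l = v.
  apply: KP nacc => i z; apply: le_trans (run_mono z kl).
  apply: le_trans (kP i z); rewrite ler_wpM2r//.
    exact: (posdefmx_psd (pD i)).2.
  apply: le_trans (ler_norm _) _; exact: ltW (archi_boundP (normr_ge0 K)).
rewrite -uv in st.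
have ku := fixed_point_kkt rho0 gamma0 cpf (run_psd l) st.
exists (u l); split=> //.
have stat j : (l <= j)%N -> u j = u l.
  by move=> /subnKC <-; exact: kkt_iterate_stationary.
split=> [i|]; apply: cvg_near_cst; exists l => // j /= lj; by rewrite stat.
Qed.

(** The tail after the last rejection has constant matrices and accepted steps only. Well-posedness
    is passed on for [P 0], which [P K] dominates. *)
Lemma finitely_rejected_converges : 0 < eta -> well_posed A c f rho (P 0%N) ->
  (exists w, kkt_point A c f w) ->
  (exists K, forall k, (K <= k)%N -> ~ rejected k) ->
  exists w, kkt_point A c f w /\ converges_to u w.
Proof.
move=> eta0 wP [w0 kw0] [K nrej].
pose uK j := u (j + K)%N.
have good j : [/\ admm_step A c f rho gamma (P (j + K)%N) (uK j) (uK j.+1),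
    accept A rho gamma eta (P (j + K)%N) (uK j) (uK j.+1)
    & P (j.+1 + K)%N = P (j + K)%N].
  have [v [st [[ac [uv PP]]|[nac [_ inc]]]]] := run (j + K).
    by rewrite /uK addSn uv.
  by case: (nrej _ (leq_addl j K)); exists v.
have PK j : P (j + K)%N = P K.
  by elim: j => // j IH; have [_ _ ->] := good j.
have stepK j : admm_step A c f rho gamma (P K) (uK j) (uK j.+1).
  by have [st _ _] := good j; rewrite -(PK j).
have accK j : accept A rho gamma eta (P K) (uK j) (uK j.+1).
  by have [_ ac _] := good j; rewrite -(PK j).
have [w [kw [w1 w2]]] := accepted_steps_converge rho0 gamma0 eta0 cpf pP0
  (run_psd K) (fun i z => run_mono z (leq0n K)) wP stepK accK kw0.
exists w; split=> //; split=> [i|].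
  by have := w1 i; rewrite (cvg_shiftn K (fun k => (u k).1 i)).
by have := w2; rewrite (cvg_shiftn K (fun k => (u k).2)).
Qed.

End AdaptiveRun.

Theorem theorem2p6 (R : realType) (N m : nat) (n : 'I_N -> nat)
  (A : forall i, 'M[R]_(m, n i)) (c : 'cV[R]_m)
  (f : forall i, 'cV[R]_(n i) -> \bar R)
  (rho gamma eta : R) (alpha beta : 'I_N -> R) (Q : forall i, 'M[R]_(n i))
  (u : nat -> iterate R N m n) (P : nat -> forall i, 'M[R]_(n i))
  (hN : (2 <= N)%N)
  (hf : forall i, closed_proper_convex (f i))
  (hkkt : exists w : iterate R N m n, kkt_point A c f w)
  (hrho : 0 < rho) (hgamma : 0 < gamma)
  (* eta is sufficiently small: below this bound, every nontrivial step is
     accepted once the P i are large enough (see h and accept) *)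
  (heta0 : 0 < eta) (heta : eta < Num.min 1 (2 / gamma - 1))
  (halpha : forall i, 1 < alpha i) (hbeta : forall i, 0 <= beta i)
  (hQ : forall i, posdefmx (Q i))
  (hP0 : forall i, psdmx (P 0%N i))
  (hwp : well_posed A c f rho (P 0%N))
  (hrun : adaptive_run A c f rho gamma eta alpha beta Q u P) :
  exists w : iterate R N m n, kkt_point A c f w /\ converges_to u w.
Proof.
have [rej|] := pselect (forall K, exists2 k, (K <= k)%N
    & rejected A c f rho gamma eta alpha beta Q u P k).
  exact: (infinitely_rejected_converges hrho hgamma hf halpha hP0 hrun
    (ltnW hN) heta rej).
move=> /existsNP[K nK].
apply: (finitely_rejected_converges hrho hgamma hf hP0 hrun heta0 hwp hkkt).
by exists K => k Kk rk; apply: nK; exists k.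
Qed.
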